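(* Let $X$ be a real Banach space. (a) $f \in S(X^* )$ is a w*-semidenting point of $B(X^* )$ if and only if $d_0^*(f,t) > 0$ for every $0<t<2$. (b) $X$ has the Mazur Intersection Property if and only if $d_0^*(f,t) > 0$ for every $f \in S(X^* )$ and every $t \in (0,2)$. (c) $X$ has the Uniform Mazur Intersection Property if and only if $d_0^*(t) > 0$ for every $t \in (0,2)$.
   Context: $B(\cdot)$, $S(\cdot)$ denote closed unit ball and unit sphere; $B(f,\varepsilon)$ the open ball. For $x \in S(X)$ and real $\alpha$, $S(B(X^* ), x, \alpha) := \{g \in B(X^* ) : g(x) > \alpha\}$. $f \in S(X^* )$ is a w*-semidenting point of $B(X^* )$ if for every $\varepsilon>0$ there exist $0<\alpha<1$ and $x \in S(X)$ with $S(B(X^* ),x,\alpha) \subseteq B(f,\varepsilon)$. $X$ has the Mazur Intersection Property (MIP) if every closed bounded convex subset of $X$ is the intersection of the closed balls containing it. $X$ has the Uniform MIP (UMIP) if for every $\varepsilon>0$ there is $K>0$ such that for every closed bounded convex $C \subseteq X$ and $p \in X$ with $\operatorname{diam}(C) < 1/\varepsilon$ and $d(p,C) \geq \varepsilon$, there is a closed ball $B[x_0,r_0] \supseteq C$ with $d(p, B[x_0,r_0]) \geq \varepsilon/2$ and $r_0 \leq K$. For $0<t<2$, $f \in S(X^* )$, $x \in S(X)$: $s^*(f,x,t) := \inf\{\|f+h\| - 1 : h \in X^*,\ \|h\| \geq t/4,\ h(x)=0\}$; $d^*(g,t) := \sup_{x\in S(X)} s^*(g,x,t)$; $d_0^*(f,t)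 := \sup\{s^*(g,x,t) : x \in S(X),\ g \in S(X^* ),\ \|f-g\| < t\}$; $d_0^*(t) := \inf_{f \in S(X^* )} d_0^*(f,t)$. *)

(* Defs.v *)
From HB Require Import structures.
From mathcomp Require Import all_boot all_order all_algebra.
From mathcomp Require Import all_classical all_reals all_analysis.
Set Implicit Arguments. Unset Strict Implicit. Unset Printing Implicit Defensive.
Import Order.TTheory GRing.Theory Num.Theory.
Import numFieldNormedType.Exports.
Local Open Scope classical_set_scope.
Local Open Scope ring_scope.

Section Defs.
Variables (R : realType) (X : normedModType R).

Definition is_dual (f : X -> R) : Prop :=
  (forall (a : R) (x y : X), f (a *: x + y) = a * f x + f y) /\ continuous f.

Definition dnorm (f : X -> R) : R := sup [set `|f x| | x in [set x : X | `|x| <= 1]].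

Definition unit_sphere : set X := [set x | `|x| = 1].
Definition dual_sphere : set (X -> R) := [set f | is_dual f /\ dnorm f = 1].
Definition dual_ball : set (X -> R) := [set f | is_dual f /\ dnorm f <= 1].

Definition dslice (x : X) (alpha : R) : set (X -> R) :=
  [set g | dual_ball g /\ g x > alpha].

Definition dball (f : X -> R) (eps : R) : set (X -> R) :=
  [set g | is_dual g /\ dnorm (g \- f) < eps].

Definition w_semidenting (f : X -> R) : Prop :=
  forall eps : R, 0 < eps ->
    exists alpha : R, exists x : X,
      0 < alpha < 1 /\ unit_sphere x /\ dslice x alpha `<=` dball f eps.

Definition cball (x0 : X) (r : R) : set X := [set y | `|y - x0| <= r].

Definition convex_set_X (C : set X) : Prop :=
  forall x y : X, C x -> C y -> forall t : R, 0 <= t <= 1 -> C (t *: x + (1 - t) *: y).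

Definition cbc (C : set X) : Prop :=
  C !=set0 /\ closed C /\ bounded_set C /\ convex_set_X C.

Definition MIP : Prop :=
  forall C : set X, cbc C ->
    C = \bigcap_(i in [set i : X * R | C `<=` cball i.1 i.2]) cball i.1 i.2.

Definition diam (C : set X) : R := sup [set `|x - y| | x in C & y in C].

Definition dist (p : X) (A : set X) : R := inf [set `|p - y| | y in A].

Definition UMIP : Prop :=
  forall eps : R, 0 < eps -> exists K : R, 0 < K /\
    forall (C : set X) (p : X), cbc C -> diam C < eps^-1 -> dist p C >= eps ->
      exists x0 : X, exists r0 : R,
        C `<=` cball x0 r0 /\ dist p (cball x0 r0) >= eps / 2 /\ r0 <= K.

Local Open Scope ereal_scope.

(* s^*(f,x,t) = inf { ||f+h|| - 1 : h in Xdual, ||h|| >= t/4, h x = 0 }, in \bar R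
   (inf of the empty set is +oo) *)
Definition s_star (f : X -> R) (x : X) (t : R) : \bar R :=
  ereal_inf [set ((dnorm (f \+ h)) - 1)%R%:E | h in
               [set h : X -> R | is_dual h /\ (t / 4 <= dnorm h)%R /\ h x = 0%R]].

Definition d_star (g : X -> R) (t : R) : \bar R :=
  ereal_sup [set s_star g x t | x in unit_sphere].

Definition d0_star_at (f : X -> R) (t : R) : \bar R :=
  ereal_sup [set s_star gx.1 gx.2 t | gx in
               [set gx : (X -> R) * X | unit_sphere gx.2 /\ dual_sphere gx.1 /\
                                        (dnorm (f \- gx.1) < t)%R]].

Definition d0_star (t : R) : \bar R :=
  ereal_inf [set d0_star_at f t | f in dual_sphere].

End Defs.

(* Main.v *)
Require Import Defs.
From HB Require Import structures.
From mathcomp Require Import all_boot all_order all_algebra.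
From mathcomp Require Import all_classical all_reals all_analysis.
From mathcomp Require Import ring lra.
Import Order.TTheory GRing.Theory Num.Theory.
Import numFieldNormedType.Exports.
Local Open Scope classical_set_scope.
Local Open Scope ring_scope.

(* A lower bound [s^*(g,x,t) >= d] and an inclusion of the slice of x at height
   [1/(1+d)] in a ball around f are equivalent up to a constant factor in t:
   rescale a functional k of the slice so that it agrees with g at x, and,
   conversely, take for g a functional norming x. This gives (a), and a version
   of (a) that is uniform in f.

   For (b) and (c), separate p from C by f of norm one at distance d. If the
   slice of x lies close to f, the ball centred at p + l x of radius l - d/2
   contains C for l large, since a functional norming p + l x - y is either
   close to f or small at x. Conversely, let a ball B[z,r] contain the cap
   [{y | ||y|| <= 1, f y >= d}] but not 0. The functionals k of the dual ball
   with [k z > r] are positive on the cap, so f is at most d on the unit ball of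
   ker k, and Phelps' lemma shows that k is close to f. The lower bound on the
   distance from 0 to B[z,r] and the upper bound on r make the slice uniform. *)

(** * Sublinear functionals and the Hahn-Banach theorem *)

Section Sublinear.
Set Implicit Arguments. Unset Strict Implicit.
Variables (R : realType) (V : lmodType R).
Implicit Types (p q : V -> R) (f : V -> R).

Definition sublinear q :=
  (forall x y, q (x + y) <= q x + q y) /\
  (forall a x, 0 < a -> q (a *: x) <= a * q x).

(** Since [k] may depend on both [i] and [j], the infima over [i] and over [j] can be taken one
    after the other. Chains under the pointwise order satisfy this, and so do the families indexed
    by a convex cone used below. *)
Lemma sublinear_inf (I : Type) (A : set I) (F : I -> V -> R) :
  A !=set0 ->
  (forall x, has_lbound [set F i x | i in A]) ->
  (forall i j x y, A i -> A j ->
     exists2 k, A k & F k (x + y) <= F i x + F j y) ->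
  (forall i a x, A i -> 0 < a -> exists2 k, A k & F k (a *: x) <= a * F i x) ->
  sublinear (fun x => inf [set F i x | i in A]).
Proof.
move=> [i0 Ai0] lbF FD FZ.
have infF k x : A k -> inf [set F i x | i in A] <= F k x.
  by move=> Ak; apply: ge_inf => //; exists k.
have n0 x : [set F i x | i in A] !=set0 by exists (F i0 x); exists i0.
split=> [x y|a x a0].
- rewrite -lerBlDr; apply: lb_le_inf => // _ [i Ai <-].
  rewrite lerBlDr -lerBlDl; apply: lb_le_inf => // _ [j Aj <-].
  rewrite lerBlDl; have [k Ak kij] := FD i j x y Ai Aj.
  exact: le_trans (infF _ _ Ak) kij.
- rewrite -ler_pdivrMl //; apply: lb_le_inf => // _ [i Ai <-].
  rewrite ler_pdivrMl //; have [k Ak kij] := FZ i a x Ai a0.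
  exact: le_trans (infF _ _ Ak) kij.
Qed.

Lemma sublinear0 q : sublinear q -> q 0 = 0.
Proof.
move=> [_ qZ]; have := qZ 2 0 ltac:(by []); have := qZ (2^-1) 0 ltac:(by []).
by rewrite !scaler0; lra.
Qed.

Lemma sublinear_geN q x : sublinear q -> - q (- x) <= q x.
Proof.
by move=> sq; have [qD _] := sq; have := qD x (- x); rewrite subrr sublinear0 //; lra.
Qed.

Lemma superadditive_sublinear_linear q : sublinear q ->
  (forall x y, q x + q y <= q (x + y)) ->
  forall a x y, q (a *: x + y) = a * q x + q y.
Proof.
move=> sq qs; have [qD qZ] := sq.
have qDE x y : q (x + y) = q x + q y by apply/eqP; rewrite eq_le qD qs.
have qN x : q (- x) = - q x.
  by apply/eqP; rewrite -addr_eq0 -qDE addNr sublinear0.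
have qpZ a x : 0 < a -> q (a *: x) = a * q x.
  move=> a0; apply/eqP; rewrite eq_le qZ //= -ler_pdivlMl //.
  rewrite -{1}(scalerK (lt0r_neq0 a0) x); apply: qZ; by rewrite invr_gt0.
move=> a x y; rewrite qDE; congr (_ + _).
have [a0|a0|->] := ltgtP a 0; first 1 last.
- exact: qpZ.
- by rewrite scale0r sublinear0 // mul0r.
- by rewrite -(opprK a) scaleNr qN qpZ ?oppr_gt0 //; ring.
Qed.

(* The linear functionals are the minimal elements among the sublinear ones:
   for q minimal and y fixed, [x |-> inf_(t >= 0) q (x + t y) - t q y] is
   sublinear and below q, hence equal to q, so that q is superadditive. *)
Theorem hahn_banach_sublinear p : sublinear p ->
  exists f, (forall a x y, f (a *: x + y) = a * f x + f y) /\
            (forall x, f x <= p x).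
Proof.
move=> sp; pose T := {q | sublinear q /\ forall x, q x <= p x}.
(* The order is reversed, so that Zorn's lemma yields a minimal functional. *)
pose below (q r : T) := `[< forall x, sval r x <= sval q x >].
have p0 : T by exists p.
have [| | |[q [sq qp]] qmin] := @ZL_preorder T p0 below.
- by move=> q; apply/asboolP.
- move=> q r s /asboolP rq /asboolP sr; apply/asboolP => x.
  exact: le_trans (sr x) (rq x).
- move=> A totA; have [[q0 Aq0]|A0] := pselect (A !=set0); last first.
    by exists p0 => q Aq; case: A0; exists q.
  have lbA x : has_lbound [set sval q x | q in A].
    exists (- p (- x)) => _ [[q [sq qp]] _ <-] /=.
    by apply: le_trans (sublinear_geN _ sq); rewrite lerN2.
  pose r x := inf [set sval q x | q in A].
  have rle (q : T) x : A q -> r x <= sval q x.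
    by move=> Aq; apply: ge_inf => //; exists q.
  have sr : sublinear r.
    apply: sublinear_inf => //; first by exists q0.
    - move=> q1 q2 x y A1 A2.
      have [/asboolP q21|/asboolP q12] := totA _ _ A1 A2.
        exists q2 => //; have [+ _] := (svalP q2).1 => /(_ x y) h.
        by apply: le_trans h _; rewrite lerD2r.
      exists q1 => //; have [+ _] := (svalP q1).1 => /(_ x y) h.
      by apply: le_trans h _; rewrite lerD2l.
    - by move=> q1 a x A1 a0; exists q1 => //; have [_ +] := (svalP q1).1; apply.
  have rp x : r x <= p x by apply: le_trans (rle q0 x Aq0) _; exact: (svalP q0).2.
  by exists (exist _ r (conj sr rp)) => q Aq; apply/asboolP => x; exact: rle.
exists q; split=> //; apply: superadditive_sublinear_linear => // x y.
have [qD qZ] := sq.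
pose F (t : R) x := q (x + t *: y) - t * q y.
have F0 z : F 0 z = q z by rewrite /F scale0r addr0 mul0r subr0.
have lbF z : has_lbound [set F t z | t in [set t | 0 <= t]].
  exists (- q (- z)) => _ [t /= t0 <-]; rewrite /F.
  have tq : t * q y <= q (t *: y).
    move: t0; rewrite le_eqVlt => /predU1P[<-|t0].
      by rewrite scale0r mul0r sublinear0.
    rewrite -ler_pdivlMl // -{1}(scalerK (lt0r_neq0 t0) y).
    by apply: qZ; rewrite invr_gt0.
  by have := qD (- z) (z + t *: y); rewrite addKr; lra.
pose r z := inf [set F t z | t in [set t | 0 <= t]].
have rle t z : 0 <= t -> r z <= F t z by move=> t0; apply: ge_inf => //; exists t.
have rq z : r z <= q z by rewrite -F0 rle.
have sr : sublinear r.
  apply: sublinear_inf => //; first by exists 0; rewrite /=.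
  - move=> s t u v /= s0 t0; exists (s + t); first by rewrite /= addr_ge0.
    by rewrite /F scalerDl addrACA; have := qD (u + s *: y) (v + t *: y); lra.
  - move=> t a u /= t0 a0; exists (a * t); first by rewrite /= mulr_ge0 // ltW.
    rewrite /F -scalerA -scalerDr mulrBr -mulrA; have := qZ a (u + t *: y) a0; lra.
have rp z : r z <= p z by exact: le_trans (rq z) (qp z).
(* Minimality gives [q <= r]; the member t = 1 of the family then reads q x + q y <= q (x + y). *)
have /asboolP/= := qmin (exist _ r (conj sr rp)) ltac:(by apply/asboolP).
move=> /(_ x) qr; have := le_trans qr (rle 1 x ler01).
by rewrite /F scale1r mul1r; lra.
Qed.

End Sublinear.

(** * The dual norm, separation of convex sets and Phelps' lemma *)

Section Dual.
Set Implicit Arguments. Unset Strict Implicit.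
Variables (R : realType) (X : normedModType R).
Implicit Types (f g h k : X -> R) (x y z p : X) (C : set X).

Lemma is_dual0 f : is_dual f -> f 0 = 0.
Proof. by move=> [fl _]; have := fl 1 0 0; rewrite scaler0 addr0; lra. Qed.

Lemma is_dualDE f : is_dual f -> forall x y, f (x + y) = f x + f y.
Proof. by move=> [fl _] x y; have := fl 1 x y; rewrite scale1r mul1r. Qed.

Lemma is_dualZE f : is_dual f -> forall a x, f (a *: x) = a * f x.
Proof.
by move=> df a x; have := df.1 a x 0; rewrite !addr0 (is_dual0 df) addr0.
Qed.

Lemma is_dualNE f : is_dual f -> forall x, f (- x) = - f x.
Proof. by move=> df x; rewrite -scaleN1r (is_dualZE df) mulN1r. Qed.

Lemma is_dualBE f : is_dual f -> forall x y, f (x - y) = f x - f y.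
Proof. by move=> df x y; rewrite (is_dualDE df) (is_dualNE df). Qed.

Lemma is_dual_bounded f : is_dual f ->
  exists2 M, 0 <= M & forall x, `|f x| <= M * `|x|.
Proof.
move=> df; have [_ /(_ 0)] := df.
move=> /cvgrPdist_lt /(_ 1 ltr01) /nbhs_normP[e /= e0 fe].
exists (2 / e); first by rewrite divr_ge0 // ltW.
move=> x; have [->|x0] := eqVneq x 0; first by rewrite (is_dual0 df) !normr0 mulr0.
have nx : 0 < `|x| by rewrite normr_gt0.
(* [c *: x] has norm e / 2, inside the ball on which |f| < 1. *)
pose c := e / 2 / `|x|; have c0 : 0 < c by rewrite !divr_gt0.
have := fe (c *: x); rewrite /= sub0r normrN normrZ (gtr0_norm c0) /c divfK ?lt0r_neq0 //.
move=> /(_ ltac:(lra)); rewrite (is_dual0 df) sub0r normrN (is_dualZE df) normrM (gtr0_norm c0).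
move=> h; have -> : 2 / e * `|x| = c^-1.
  rewrite /c; field; by rewrite !lt0r_neq0.
by rewrite -[leRHS]mulr1 ler_pdivlMl // ltW.
Qed.

Lemma is_dual_of_bound f M :
  (forall a x y, f (a *: x + y) = a * f x + f y) ->
  (forall x, `|f x| <= M * `|x|) -> is_dual f.
Proof.
move=> fl fM; split=> // x; apply/cvgrPdist_lt => e e0; apply/nbhs_normP.
have M0 : 0 < `|M| + 1 by have := normr_ge0 M; lra.
exists (e / (`|M| + 1)); first by rewrite /= divr_gt0.
move=> y /=; rewrite ltr_pdivlMr // => xy.
have -> : f x - f y = f (x - y).
  by have := fl (-1) y x; rewrite scaleN1r addrC => ->; ring.
apply: le_lt_trans (fM _) _; apply: le_lt_trans xy.
by rewrite mulrC ler_wpM2l //; have := ler_norm M; lra.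
Qed.

Lemma dnorm_le f M : 0 <= M -> (forall x, `|f x| <= M * `|x|) -> dnorm f <= M.
Proof.
move=> M0 fM; apply: ge_sup; first by exists `|f 0|; exists 0; rewrite //= normr0.
move=> _ [x /= x1 <-]; apply: le_trans (fM x) _.
by rewrite -[leRHS]mulr1 ler_wpM2l.
Qed.

Lemma le_dnorm_unit f x : is_dual f -> `|x| <= 1 -> `|f x| <= dnorm f.
Proof.
move=> /is_dual_bounded[M M0 fM] x1; apply: ub_le_sup; last by exists x.
exists M => _ [y /= y1 <-]; apply: le_trans (fM y) _.
by rewrite -[leRHS]mulr1 ler_wpM2l.
Qed.

Lemma dual_norm_ge0 f : is_dual f -> 0 <= dnorm f.
Proof.
move=> df; have := @le_dnorm_unit f 0 df; rewrite normr0 => /(_ ler01).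
exact: le_trans.
Qed.

Lemma le_dnorm f x : is_dual f -> `|f x| <= dnorm f * `|x|.
Proof.
move=> df; have [->|x0] := eqVneq x 0; first by rewrite (is_dual0 df) !normr0 mulr0.
have nx : 0 < `|x| by rewrite normr_gt0.
have := @le_dnorm_unit f (`|x|^-1 *: x) df.
rewrite (is_dualZE df) normrM normrZ normfV normr_id mulVf ?lt0r_neq0 //.
by move=> /(_ (lexx _)); rewrite ler_pdivrMl // mulrC.
Qed.

Lemma dual_le f x : is_dual f -> f x <= dnorm f * `|x|.
Proof. by move=> df; apply: le_trans (ler_norm _) (le_dnorm x df). Qed.

Lemma dual_ball_le f x : dual_ball f -> f x <= `|x|.
Proof.
move=> [df f1]; apply: le_trans (dual_le x df) _.
by rewrite -[leRHS]mul1r ler_wpM2r.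
Qed.

Lemma is_dualD f g : is_dual f -> is_dual g -> is_dual (f \+ g).
Proof.
move=> df dg; apply: (@is_dual_of_bound _ (dnorm f + dnorm g)) => [a x y|x] /=.
  by rewrite df.1 dg.1; ring.
by apply: le_trans (ler_normD _ _) _; rewrite mulrDl lerD // le_dnorm.
Qed.

Lemma dnorm_add_le f g : is_dual f -> is_dual g -> dnorm (f \+ g) <= dnorm f + dnorm g.
Proof.
move=> df dg; apply: dnorm_le; first by rewrite addr_ge0 // dual_norm_ge0.
by move=> x /=; apply: le_trans (ler_normD _ _) _; rewrite mulrDl lerD // le_dnorm.
Qed.

Lemma is_dualZ f a : is_dual f -> is_dual (fun x => a * f x).
Proof.
move=> df; apply: (@is_dual_of_bound _ (`|a| * dnorm f)) => [b x y|x] /=.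
  by rewrite df.1; ring.
by rewrite normrM -mulrA ler_wpM2l // le_dnorm.
Qed.

Lemma dnorm_scale_le f a : is_dual f -> dnorm (fun x => a * f x) <= `|a| * dnorm f.
Proof.
move=> df; apply: dnorm_le; first by rewrite mulr_ge0 // dual_norm_ge0.
by move=> x; rewrite normrM -mulrA ler_wpM2l // le_dnorm.
Qed.

Lemma dnorm_scale f a : is_dual f -> dnorm (fun x => a * f x) = `|a| * dnorm f.
Proof.
move=> df; apply/eqP; rewrite eq_le dnorm_scale_le //=.
have [->|a0] := eqVneq a 0.
  by rewrite normr0 mul0r dual_norm_ge0 //; exact: is_dualZ.
rewrite -ler_pdivlMl ?normr_gt0 //.
have := dnorm_scale_le a^-1 (is_dualZ a df).
rewrite normfV; apply: le_trans; rewrite le_eqVlt; apply/orP; left; apply/eqP.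
by congr dnorm; apply/funext => x; rewrite mulKf.
Qed.

Lemma is_dualB f g : is_dual f -> is_dual g -> is_dual (f \- g).
Proof.
move=> df dg; have := is_dualD df (is_dualZ (-1) dg).
by congr is_dual; apply/funext => x /=; rewrite mulN1r.
Qed.

Lemma dnorm_distC f g : is_dual f -> is_dual g -> dnorm (f \- g) = dnorm (g \- f).
Proof.
move=> df dg; rewrite -[RHS]mul1r -normr1 -normrN -dnorm_scale; last exact: is_dualB.
by congr dnorm; apply/funext => x /=; ring.
Qed.

Lemma dnorm_triangle g f h : is_dual f -> is_dual g -> is_dual h ->
  dnorm (f \- h) <= dnorm (f \- g) + dnorm (g \- h).
Proof.
move=> df dg dh.
have <- : (f \- g) \+ (g \- h) = f \- h by apply/funext => x /=; ring.
by apply: dnorm_add_le; apply: is_dualB.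
Qed.

Lemma dnorm_sub_ge f g : is_dual f -> is_dual g -> dnorm f - dnorm g <= dnorm (f \- g).
Proof.
move=> df dg; rewrite lerBlDr.
have {1}-> : f = (f \- g) \+ g by apply/funext => x /=; ring.
by apply: dnorm_add_le => //; exact: is_dualB.
Qed.

Lemma dual_norm_gt0P f : is_dual f -> 0 < dnorm f -> exists x, f x != 0.
Proof.
move=> df f0; apply: contrapT => nf; move: f0; apply/negP; rewrite -leNgt.
apply: dnorm_le => // x; rewrite mul0r normr_le0; apply/negPn/negP => fx.
by apply: nf; exists x.
Qed.

Lemma dual_sphere_ball f : dual_sphere f -> dual_ball f.
Proof. by move=> [df f1]; split=> //; rewrite f1. Qed.

(* A linear f lying below [v |-> inf ||v + s (y - p)|| - s d], over s >= 0 and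
   y in C, satisfies f <= ||.|| (s = 0) and f (p - y) <= - d (s = 1). *)
Lemma separation C p (d : R) : C !=set0 -> convex_set_X C ->
  (forall y, C y -> d <= `|y - p|) ->
  exists2 f, dual_ball f & forall y, C y -> d <= f y - f p.
Proof.
move=> [c0 Cc0] convC dC.
pose A := [set sw : R * X | 0 <= sw.1 /\ exists2 y, C y & sw.2 = sw.1 *: (y - p)].
pose F (sw : R * X) v := `|v + sw.2| - sw.1 * d.
have lbF v : has_lbound [set F i v | i in A].
  exists (- `|v|) => _ [[s w] [/= s0 [y Cy /= ->]] <-]; rewrite /F /=.
  have h1 : s * d <= `|s *: (y - p)|.
    by rewrite normrZ ger0_norm // ler_wpM2l // dC.
  have h2 := ler_normB (v + s *: (y - p)) v; rewrite addrC addKr in h2.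
  lra.
have sF : sublinear (fun v => inf [set F i v | i in A]).
  apply: sublinear_inf => //.
  - by exists (0, 0); split=> //=; exists c0 => //; rewrite scale0r.
  - move=> [s w] [t w'] x y /= [/= s0 [u Cu /= ->]] [/= t0 [v Cv /= ->]].
    exists (s + t, s *: (u - p) + t *: (v - p)).
      split=> /=; first exact: addr_ge0.
      (* If s + t = 0, both weights vanish and any point of [C] serves; otherwise convexity supplies
         the average of u and v with weights s / (s + t) and t / (s + t). *)
      have [st|st] := eqVneq (s + t) 0.
        have -> : s = 0 by lra.
        have -> : t = 0 by lra.
        by exists c0 => //; rewrite !scale0r !addr0 scale0r.
      exists ((s / (s + t)) *: u + (1 - s / (s + t)) *: v).
        have st0 : 0 < s + t by rewrite lt_neqAle eq_sym st addr_ge0.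
        apply: convC => //; rewrite divr_ge0 ?addr_ge0 //=.
        by rewrite ler_pdivrMr // mul1r; lra.
      have -> : 1 - s / (s + t) = t / (s + t) by field.
      rewrite [RHS]scalerBr [in RHS]scalerDr !scalerA !(mulrC (s + t)) !divfK //.
      by rewrite !scalerBr scalerDl opprD addrACA.
    rewrite /F /= addrACA.
    have := ler_normD (x + s *: (u - p)) (y + t *: (v - p)); lra.
  - move=> [s w] a x /= [/= s0 [u Cu /= ->]] a0.
    exists (a * s, a *: (s *: (u - p))).
      by split=> /=; [rewrite mulr_ge0 // ltW|exists u => //; rewrite scalerA].
    rewrite /F /= -scalerDr normrZ (gtr0_norm a0); lra.
have [f [fl fF]] := hahn_banach_sublinear sF.
have Fle sw v : A sw -> f v <= F sw v.
  by move=> Asw; apply: le_trans (fF v) _; apply: ge_inf => //; exists sw.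
have f1 v : f v <= `|v|.
  have := Fle (0, 0) v; rewrite /F /= addr0 mul0r subr0; apply.
  by split=> //=; exists c0 => //; rewrite scale0r.
have f0 : f 0 = 0 by have := fl 1 0 0; rewrite scaler0 addr0; lra.
have fN v : f (- v) = - f v.
  by have := fl (-1) v 0; rewrite scaleN1r !addr0 f0; lra.
have fn v : `|f v| <= 1 * `|v|.
  by rewrite mul1r ler_norml f1 andbT lerNl -fN -(normrN v) f1.
have df : is_dual f by exact: is_dual_of_bound fl fn.
exists f; first by split=> //; exact: dnorm_le.
move=> y Cy; have := Fle (1, y - p) (- (y - p)).
rewrite /F /= addNr normr0 mul1r fN (is_dualBE df) => h.
suff : - (f y - f p) <= 0 - d by lra.
by apply: h; split=> //=; exists y => //; rewrite scale1r.
Qed.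

(** This is separation of the singleton of [x] from 0 at distance [|x|]; the value 0 of the distance
    is allowed, so [x] = 0 is covered. *)
Lemma norming_functional x : exists2 f, dual_ball f & f x = `|x|.
Proof.
have [| |y ->|f bf /(_ x erefl)] := @separation [set x] 0 `|x|.
- by exists x.
- by move=> u v -> -> t _ /=; rewrite -scalerDl addrC subrK scale1r.
- by rewrite subr0.
move=> fx; exists f => //; apply/eqP; rewrite eq_le dual_ball_le //=.
by have [df _] := bf; move: fx; rewrite (is_dual0 df) subr0.
Qed.

Lemma norming_sphere x : unit_sphere x -> exists2 f, dual_sphere f & f x = 1.
Proof.
move=> x1; have [f bf fx] := norming_functional x; exists f; last by rewrite fx.
have [df f1] := bf; split=> //; apply/eqP; rewrite eq_le f1 /=.
by have := dual_le x df; rewrite fx x1 mulr1.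
Qed.

(** A positive gap makes the separating functional nonzero, and dividing by its norm, which is at
    most 1, can only widen the gap. *)
Lemma separation_sphere C p (d : R) : 0 < d -> C !=set0 -> convex_set_X C ->
  (forall y, C y -> d <= `|y - p|) ->
  exists2 f, dual_sphere f & forall y, C y -> d <= f y - f p.
Proof.
move=> d0 C0 convC dC; have [f [df f1] fC] := separation C0 convC dC.
have [c Cc] := C0; have cp : 0 < f (c - p).
  by rewrite (is_dualBE df); exact: lt_le_trans (fC c Cc).
have f0 : 0 < dnorm f.
  rewrite lt_neqAle dual_norm_ge0 // andbT; apply/eqP => f0.
  by have := dual_le (c - p) df; rewrite -f0 mul0r leNgt cp.
exists (fun x => (dnorm f)^-1 * f x).
  split; first exact: is_dualZ.
  by rewrite dnorm_scale // gtr0_norm ?invr_gt0 // mulVf // lt0r_neq0.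
move=> y Cy; rewrite -mulrBr; apply: le_trans (fC y Cy) _.
have fyp := lt_le_trans d0 (fC y Cy).
by rewrite ler_pdivlMl // -[leRHS]mul1r ler_wpM2r // ltW.
Qed.

(* Any l between [sup {f v - d ||v|| | k v = 1}] and
   [inf {d ||w|| - f w | k w = -1}] works; the hypothesis on [v + w], which
   lies in the kernel of k, puts these two in the right order. *)
Lemma phelps f k (d : R) : is_dual f -> is_dual k -> 0 < dnorm k -> 0 <= d ->
  (forall x, k x = 0 -> f x <= d * `|x|) ->
  exists l : R, dnorm (f \- (fun x => l * k x)) <= d.
Proof.
move=> df dk k0 d0 fd; have [u0 ku0] := dual_norm_gt0P dk k0.
pose u := (k u0)^-1 *: u0; have ku : k u = 1 by rewrite (is_dualZE dk) mulVf.
pose S := [set f v - d * `|v| | v in [set v | k v = 1]].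
have ubS w : k w = -1 -> ubound S (d * `|w| - f w).
  move=> kw _ [v /= kv <-]; have := fd (v + w); rewrite (is_dualDE df) (is_dualDE dk) kv kw.
  rewrite subrr => /(_ erefl) h.
  have : d * `|v + w| <= d * `|v| + d * `|w| by rewrite -mulrDr ler_wpM2l // ler_normD.
  lra.
have nu : k (- u) = -1 by rewrite (is_dualNE dk) ku.
exists (sup S); set l := sup S.
have le1 v : k v = 1 -> f v - d * `|v| <= l.
  by move=> kv; apply: ub_le_sup; [exists (d * `|- u| - f (- u)); exact: ubS|exists v].
have le2 w : k w = -1 -> l <= d * `|w| - f w.
  by move=> kw; apply: ge_sup; [exists (f u - d * `|u|); exists u|exact: ubS].
have le v : f v - l * k v <= d * `|v|.
  have [kv|kv|kv] := ltgtP (k v) 0; last by rewrite kv mulr0 subr0 fd.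
  - have c0 : 0 < - k v by lra.
    have := le2 ((- k v)^-1 *: v).
    rewrite (is_dualZE df) (is_dualZE dk) normrZ normfV (gtr0_norm c0).
    rewrite [X in X = _]mulrC -{1}(opprK (k v)) mulNr mulfV ?lt0r_neq0 //.
    rewrite mulrCA -mulrBr ler_pdivlMl // => /(_ erefl); lra.
  - have := le1 ((k v)^-1 *: v).
    rewrite (is_dualZE df) (is_dualZE dk) normrZ normfV (gtr0_norm kv).
    rewrite mulVf ?lt0r_neq0 //.
    rewrite mulrCA -mulrBr ler_pdivrMl // => /(_ erefl); lra.
apply: dnorm_le => // x; rewrite /= ler_norml le andbT.
by have := le (- x); rewrite normrN (is_dualNE df) (is_dualNE dk); lra.
Qed.
End Dual.

(** * Slices of the dual ball and lower bounds on s* *)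

Section Slices.
Set Implicit Arguments. Unset Strict Implicit.
Variables (R : realType) (X : normedModType R).
Implicit Types (f g h k : X -> R) (x y z p : X) (C : set X).

Lemma le_s_starP g x (t d : R) : (d%:E <= s_star g x t)%E <->
  forall h, is_dual h -> t / 4 <= dnorm h -> h x = 0 -> 1 + d <= dnorm (g \+ h).
Proof.
split=> [ds h dh th hx|H].
- have : ((dnorm (g \+ h) - 1)%:E >= s_star g x t)%E.
    by apply: ereal_inf_lbound; exists h.
  by move=> /(le_trans ds); rewrite lee_fin; lra.
- apply: le_ereal_inf_tmp => _ [h [dh [th hx]] <-].
  by rewrite lee_fin lerBrDl; exact: H.
Qed.

(* If k lies in the slice and k' is its multiple with k' x = g x, then k' - g
   vanishes at x while ||k'|| < 1 + d, so ||k' - g|| < t / 4; since ||g|| = 1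
   this also forces k' to be close to k. *)
Lemma slice_of_s_star_pos f g x (t d : R) :
  0 < t -> 0 < d <= t / 4 -> unit_sphere x -> is_dual f -> dual_sphere g ->
  dnorm (f \- g) < t -> 0 < g x -> (d%:E <= s_star g x t)%E ->
  dslice x (1 + d)^-1 `<=` dball f (2 * t).
Proof.
move=> t0 /andP[d0 dt] x1 df sg fg gx0 /le_s_starP ds k [[dk k1] kx].
have [dg g1] := sg.
have gx1 : g x <= 1.
  by have := dual_ball_le x (dual_sphere_ball sg); rewrite x1.
have d1 : 0 < (1 + d)^-1 by rewrite invr_gt0; lra.
have kx0 : 0 < k x by exact: lt_trans kx.
pose c := g x / k x; have c0 : 0 < c by exact: divr_gt0.
have cd : c < 1 + d.
  rewrite /c ltr_pdivrMr //; apply: le_lt_trans gx1 _.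
  by rewrite -ltr_pdivrMl ?mulr1 //; lra.
pose k' := fun y => c * k y.
have dk' : is_dual k' by exact: is_dualZ.
have nk' : dnorm k' = c * dnorm k by rewrite dnorm_scale // gtr0_norm.
have k0 := dual_norm_ge0 dk.
have k'g : dnorm (k' \- g) < t / 4.
  rewrite ltNge; apply/negP => tk.
  have := ds (k' \- g) (is_dualB dk' dg) tk.
  rewrite /= /k' /c divfK ?lt0r_neq0 // subrr => /(_ erefl).
  have -> : g \+ (k' \- g) = k' by apply/funext => y /=; ring.
  rewrite nk'; have : c * dnorm k <= c by rewrite -[leRHS]mulr1 ler_wpM2l // ltW.
  lra.
have gk' := dnorm_sub_ge dg dk'; rewrite g1 (dnorm_distC dg dk') nk' in gk'.
have kk' : dnorm (k \- k') <= t / 4.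
  have -> : k \- k' = (fun y => (1 - c) * k y) by apply/funext => y; rewrite /k' /=; ring.
  (* If c <= 1, then (1 - c) ||k|| <= 1 - c ||k|| <= t / 4 by [gk']; if c > 1, then c - 1 < d <= t /
     4. *)
  rewrite dnorm_scale //; have [c1|c1] := leP 0 (1 - c).
    by rewrite ger0_norm //; lra.
  rewrite ltr0_norm //; apply: le_trans dt.
  by apply: (@le_trans _ _ (- (1 - c) * 1)); [rewrite ler_wpM2l //|]; lra.
split=> //; rewrite (dnorm_distC df dg) in fg.
have := dnorm_triangle dk dk' df; have := dnorm_triangle dk' dg df; lra.
Qed.

Lemma unit_sphereN x : unit_sphere x -> unit_sphere (- x).
Proof. by rewrite /unit_sphere /= normrN. Qed.

(** The constraint h x = 0 does not see the sign of x, so - x may replace x to make g positive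
    there. *)
Lemma slice_of_s_star f g x (t d : R) :
  0 < t < 2 -> 0 < d <= t / 4 -> unit_sphere x -> is_dual f -> dual_sphere g ->
  dnorm (f \- g) < t -> (d%:E <= s_star g x t)%E ->
  exists2 y, unit_sphere y & dslice y (1 + d)^-1 `<=` dball f (2 * t).
Proof.
move=> /andP[t0 t2] dt x1 df sg fg ds; have [dg g1] := sg; have d0 : 0 < d by case/andP: dt.
have [gx|gx|gx] := ltgtP (g x) 0.
- exists (- x); first exact: unit_sphereN.
  apply: (slice_of_s_star_pos t0 dt (unit_sphereN x1) df sg fg).
    by rewrite (is_dualNE dg) oppr_gt0.
  apply/le_s_starP => h dh th hx; move/le_s_starP: ds; apply=> //.
  by move: hx; rewrite (is_dualNE dh) => /eqP; rewrite oppr_eq0 => /eqP.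
- by exists x => //; exact: (slice_of_s_star_pos t0 dt x1 df sg fg).
- (* g x = 0 is impossible: h = - g would give ||g + h|| = 0 *)
  move/le_s_starP: ds => /(_ (fun y => -1 * g y) (is_dualZ (-1) dg)).
  rewrite dnorm_scale // normrN normr1 mul1r g1 gx mulr0 => /(_ ltac:(lra) erefl).
  have : dnorm (g \+ (fun y => -1 * g y)) <= 0.
    by apply: dnorm_le => // y /=; rewrite mulN1r subrr normr0 mul0r.
  lra.
Qed.

(** Take g norming x; it lies in the slice. If h x = 0 and n = ||g + h|| < 1 + d, then (g + h) / n
    takes at x the value 1 / n > alpha, so it lies in the slice too and is within t / 8 of g. Hence
    ||h|| < d + t / 8 <= t / 4. *)
Lemma d0_star_at_of_slice f x (t alpha d : R) :
  0 < t -> 0 < alpha < 1 -> d <= t / 8 -> d <= alpha^-1 - 1 -> unit_sphere x -> is_dual f ->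
  dslice x alpha `<=` dball f (t / 16) -> (d%:E <= d0_star_at f t)%E.
Proof.
move=> t0 /andP[a0 a1] dt da x1 df sl.
have [g sg gx] := norming_sphere x1; have [dg g1] := sg.
have [_ gf] : dball f (t / 16) g.
  by apply: sl; split; [exact: dual_sphere_ball|rewrite gx].
apply: (@le_trans _ _ (s_star g x t)); last first.
  apply: ereal_sup_ubound; exists (g, x) => //=; split=> //; split=> //.
  by rewrite (dnorm_distC df dg); lra.
apply/le_s_starP => h dh th hx; rewrite leNgt; apply/negP => gh.
have dgh := is_dualD dg dh.
set n := dnorm (g \+ h) in gh.
have n1 : 1 <= n.
  by have := dual_le x dgh; rewrite /= gx hx x1 mulr1 addr0.
have n0 : 0 < n by lra.
pose k := fun y => n^-1 * (g \+ h) y; have dk : is_dual k by exact: is_dualZ.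
have [_ kf] : dball f (t / 16) k.
  apply: sl; split.
    split=> //; rewrite dnorm_scale // gtr0_norm ?invr_gt0 //.
    by rewrite -/n mulVf // lt0r_neq0.
  rewrite /k /= gx hx addr0 mulr1 -[alpha]invrK ltf_pV2 ?posrE ?invr_gt0 //; lra.
have ghk : dnorm ((g \+ h) \- k) <= n - 1.
  have -> : (g \+ h) \- k = (fun y => (1 - n^-1) * (g \+ h) y).
    by apply/funext => y; rewrite /k /=; ring.
  rewrite dnorm_scale // -/n ger0_norm; last by rewrite subr_ge0 invf_le1.
  by rewrite mulrBl mulVf ?lt0r_neq0 // mul1r.
have := dnorm_triangle dk df dg; rewrite (dnorm_distC df dg).
have := dnorm_triangle dgh dk dg.
have -> : (g \+ h) \- g = h by apply/funext => y /=; ring.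
lra.
Qed.

(* A functional norming [p + l x - y] either lies in the slice, hence is close
   to f, or is at most alpha at x. *)
Lemma slice_ball f x y p (alpha e M d l : R) :
  0 <= e -> 0 <= l -> unit_sphere x -> is_dual f ->
  dslice x alpha `<=` dball f e -> d <= f y - f p -> `|y - p| <= M ->
  M + d <= l * (1 - alpha) -> `|y - (p + l *: x)| <= l - (d - e * M).
Proof.
move=> e0 l0 x1 df sl dy yM hl; rewrite distrC.
have [k bk <-] := norming_functional (p + l *: x - y); have [dk k1] := bk.
have M0 : 0 <= M by apply: le_trans yM.
have kyp := dual_ball_le (p - y) bk; rewrite distrC in kyp.
rewrite addrAC (is_dualDE dk) (is_dualZE dk).
have [kx|kx] := ltP alpha (k x).
- have [_ kf] : dball f e k by exact: sl.
  have dkf := is_dualB dk df.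
  have := dual_le (p - y) dkf; rewrite /= distrC (is_dualBE df) => h1.
  have : dnorm (k \- f) * `|y - p| <= e * M by apply: ler_pM => //; [exact: dual_norm_ge0|exact: ltW].
  have : l * k x <= l.
    by rewrite -[leRHS]mulr1 ler_wpM2l //; have := dual_ball_le x bk; rewrite x1.
  lra.
(* Here k (p - y) <= M, and [hl] says that l alpha + M <= l - d. *)
- have : l * k x <= l * alpha by rewrite ler_wpM2l.
  have : 0 <= e * M by rewrite mulr_ge0.
  lra.
Qed.

(** * Caps of the unit ball and the balls containing them *)

Definition dual_cap f (d : R) : set X := [set y | `|y| <= 1 /\ d <= f y].

Lemma dual_cap_approx f (d : R) : dual_sphere f -> d < 1 ->
  exists2 y, dual_cap f d y & d < f y.
Proof.
move=> [df f1] d1.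
have [| |_ [y /= y1 <-]] := @sup_gt _ [set `|f x| | x in [set x : X | `|x| <= 1]] d.
- by exists `|f 0|; exists 0; rewrite //= normr0.
- by rewrite -/(dnorm f) f1.
move=> dy; have [fy|fy] := leP 0 (f y).
- by rewrite ger0_norm // in dy; exists y => //; split=> //; exact: ltW.
- rewrite ltr0_norm // in dy; exists (- y); rewrite ?(is_dualNE df) //.
  by split; rewrite ?normrN // (is_dualNE df) ltW.
Qed.

Lemma cbc_dual_cap f (d : R) : dual_sphere f -> d < 1 -> cbc (dual_cap f d).
Proof.
move=> sf d1; have [df f1] := sf; split.
  by have [y Cy _] := dual_cap_approx sf d1; exists y.
split.
  have -> : dual_cap f d = ((fun x : X => `|x|) @^-1` [set r : R | r <= 1]) `&` (f @^-1` [set r : R | d <= r]).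
    by [].
  apply: closedI; apply: closed_comp => //.
  - by move=> x _; exact: norm_continuous.
  - by move=> x _; exact: df.2.
split.
  exists 1; split=> // M M1 y [y1 _] /=; apply: le_trans y1 _; exact: ltW.
move=> x y [x1 fx] [y1 fy] t /andP[t0 t1]; split.
  apply: le_trans (ler_normD _ _) _; rewrite !normrZ !ger0_norm //; last lra.
  have : t * `|x| <= t * 1 by rewrite ler_wpM2l.
  have : (1 - t) * `|y| <= (1 - t) * 1 by rewrite ler_wpM2l //; lra.
  lra.
rewrite (is_dualDE df) !(is_dualZE df).
have : t * d <= t * f x by rewrite ler_wpM2l.
have : (1 - t) * d <= (1 - t) * f y by rewrite ler_wpM2l //; lra.
lra.
Qed.

(* The functionals of the slice are positive on the cap, so f is at most d on
   the unit ball of their kernels and Phelps' lemma applies. *)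
Lemma slice_of_ball f z (r alpha d : R) : dual_sphere f -> 0 < d < 1 ->
  dual_cap f d `<=` cball z r -> r < `|z| -> r / `|z| <= alpha -> 1 - d <= alpha ->
  dslice (`|z|^-1 *: z) alpha `<=` dball f (4 * d).
Proof.
move=> sf /andP[d0 d1] capz rz ra da k [bk kz].
have [df f1] := sf; have [dk k1] := bk.
have [y0 Cy0 fy0] := dual_cap_approx sf d1.
have r0 : 0 <= r by apply: le_trans (capz _ Cy0).
have z0 : 0 < `|z| by exact: le_lt_trans rz.
rewrite (is_dualZE dk) in kz.
have rkz : r < k z.
  have := le_lt_trans ra kz; rewrite [ltRHS]mulrC ltr_pM2r ?invr_gt0 //.
(* On the ball k (z - y) <= r, whereas k z > r. *)
have kC y : dual_cap f d y -> 0 < k y.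
  move=> /capz yz; have := dual_ball_le (z - y) bk.
  rewrite (is_dualBE dk) distrC; rewrite /cball /= in yz; lra.
have nk : 1 - d < dnorm k.
  have := dual_le (`|z|^-1 *: z) dk.
  rewrite (is_dualZE dk) normrZ normfV normr_id mulVf ?lt0r_neq0 // mulr1; lra.
have kf x : k x = 0 -> f x <= d * `|x|.
  move=> kx; have [->|x0] := eqVneq x 0; first by rewrite (is_dual0 df) normr0 mulr0.
  have nx : 0 < `|x| by rewrite normr_gt0.
  rewrite leNgt; apply/negP => fx.
  have : 0 < k (`|x|^-1 *: x).
    apply: kC; split; first by rewrite normrZ normfV normr_id mulVf // lt0r_neq0.
    by rewrite (is_dualZE df) ler_pdivlMl // mulrC ltW.
  by rewrite (is_dualZE dk) kx mulr0 ltxx.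
have [l lk] : exists l : R, dnorm (f \- (fun x => l * k x)) <= d.
  by apply: phelps => //; lra.
have dlk : is_dual (fun x => l * k x) by exact: is_dualZ.
(* The strict inequality f y0 > d enters here: l k y0 >= f y0 - d > 0 and k y0 > 0. *)
have l0 : 0 < l.
  have := dual_le y0 (is_dualB df dlk); rewrite /= => h.
  have : dnorm (f \- (fun x => l * k x)) * `|y0| <= d * 1.
    by apply: ler_pM => //; [apply: dual_norm_ge0; exact: is_dualB|exact: Cy0.1].
  move=> h'; rewrite -(pmulr_lgt0 _ (kC _ Cy0)); lra.
have nlk : dnorm (fun x => l * k x) = l * dnorm k by rewrite dnorm_scale // gtr0_norm.
have h1 := dnorm_sub_ge df dlk; have h2 := dnorm_sub_ge dlk df.
rewrite (dnorm_distC dlk df) in h2; rewrite f1 nlk in h1 h2.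
(* l ||k|| is within d of 1 and ||k|| lies between 1 - d and 1, so they differ by at most 2 d; with
   [lk] this puts k within 3 d < 4 d of f. *)
have lkk : dnorm ((fun x => l * k x) \- k) <= 2 * d.
  have -> : (fun x => l * k x) \- k = (fun y => (l - 1) * k y) by apply/funext => y /=; ring.
  rewrite dnorm_scale // -[X in _ * X]gtr0_norm; last lra.
  rewrite -normrM ler_norml mulrBl mul1r; lra.
split=> //; rewrite (dnorm_distC dk df).
have := dnorm_triangle df dlk dk; lra.
Qed.

End Slices.

(** * Semidenting points, the moduli d0*, and the intersection properties *)

Section Intersection.
Set Implicit Arguments. Unset Strict Implicit.
Variables (R : realType) (X : normedModType R).
Implicit Types (f : X -> R) (x y z p : X) (C : set X).

(** The middle term in the proof of (c): [alpha] is common to all f, while x may vary with f. *)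
Definition uniformly_w_semidenting : Prop :=
  forall eps : R, 0 < eps -> exists2 alpha : R, 0 < alpha < 1 &
    forall f, dual_sphere f ->
      exists2 x, unit_sphere x & dslice x alpha `<=` dball f eps.

Lemma inv1D_itv (d : R) : 0 < d -> 0 < (1 + d)^-1 < 1.
Proof.
move=> d0; rewrite invr_gt0 invf_lt1; last lra.
by apply/andP; split; lra.
Qed.

Lemma dball_subset f (e e' : R) : e <= e' -> dball f e `<=` dball f e'.
Proof. by move=> ee' g [dg ge]; split=> //; exact: lt_le_trans ee'. Qed.

Lemma slice_of_lt_d0_star_at f (t d : R) :
  0 < t < 2 -> 0 < d <= t / 4 -> dual_sphere f -> (d%:E < d0_star_at f t)%E ->
  exists2 x, unit_sphere x & dslice x (1 + d)^-1 `<=` dball f (2 * t).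
Proof.
move=> t02 dt [df f1] /ereal_sup_gt[_ [[g x] /= [x1 [sg fg]] <-] /ltW ds].
exact: (slice_of_s_star t02 dt x1 df sg fg ds).
Qed.

(** The modulus may be +oo, whereas the slice lemmas ask for a real d of size at most t / 4; [b]
    provides that cap. *)
Lemma EFin_between (u : \bar R) (b : R) : (0 < u)%E -> 0 < b ->
  exists2 d : R, 0 < d <= b & (d%:E < u)%E.
Proof.
case: u => [u|_ b0|//]; last first.
  by exists b; rewrite ?ltry // b0 lexx.
rewrite lte_fin => u0 b0; have m0 : 0 < Num.min b (u / 2).
  by rewrite lt_min b0 divr_gt0.
exists (Num.min b (u / 2)); first by rewrite m0 ge_min lexx.
by rewrite lte_fin gt_min; apply/orP; right; lra.
Qed.

Lemma param_of_eps (e : R) : 0 < e -> exists2 t : R, 0 < t < 2 & 2 * t <= e.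
Proof.
move=> e0; exists (Num.min 1 (e / 2)).
  by rewrite lt_min gt_min ltr01 divr_gt0 //= ltr1n.
suff : Num.min 1 (e / 2) <= e / 2 by lra.
by rewrite ge_min lexx orbT.
Qed.

Lemma semidentingP f : dual_sphere f ->
  w_semidenting f <-> forall t : R, 0 < t < 2 -> (0 < d0_star_at f t)%E.
Proof.
move=> sf; have [df f1] := sf; split=> [wf t /andP[t0 t2]|d0 e e0].
- have [|alpha [x [a01 [x1 sl]]]] := wf (t / 16); first by rewrite divr_gt0.
  have /andP[a0 a1] := a01.
  have ai : 0 < alpha^-1 - 1 by rewrite subr_gt0 invf_gt1.
  pose d := Num.min (t / 8) (alpha^-1 - 1).
  apply: (@lt_le_trans _ _ d%:E); first by rewrite lte_fin lt_min ai divr_gt0.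
  by apply: (d0_star_at_of_slice t0 a01 _ _ x1 df sl); rewrite ge_min lexx ?orbT.
- have [t t02 te] := param_of_eps e0; have /andP[t0 t2] := t02.
  have [|d d4 dd] := @EFin_between _ (t / 4) (d0 t t02); first by rewrite divr_gt0.
  have [x x1 sl] := slice_of_lt_d0_star_at t02 d4 sf dd.
  exists (1 + d)^-1, x; split; first by apply: inv1D_itv; case/andP: d4.
  by split=> //; apply: subset_trans sl _; exact: dball_subset.
Qed.

(** In the pointwise argument d depends only on t and [alpha], so it survives the infimum over f;
    conversely a d below the infimum gives the single height [(1 + d)^-1] for all f. *)
Lemma uniformly_semidentingP :
  uniformly_w_semidenting <-> forall t : R, 0 < t < 2 -> (0 < @d0_star R X t)%E.
Proof.
split=> [wf t /andP[t0 t2]|d0 e e0].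
- have [|alpha a01 sl] := wf (t / 16); first by rewrite divr_gt0.
  have /andP[a0 a1] := a01.
  have ai : 0 < alpha^-1 - 1 by rewrite subr_gt0 invf_gt1.
  pose d := Num.min (t / 8) (alpha^-1 - 1).
  apply: (@lt_le_trans _ _ d%:E); first by rewrite lte_fin lt_min ai divr_gt0.
  apply: le_ereal_inf_tmp => _ [f sf <-]; have [x x1 slx] := sl f sf.
  by apply: (d0_star_at_of_slice t0 a01 _ _ x1 sf.1 slx); rewrite ge_min lexx ?orbT.
- have [t t02 te] := param_of_eps e0; have /andP[t0 t2] := t02.
  have [|d d4 dd] := @EFin_between _ (t / 4) (d0 t t02); first by rewrite divr_gt0.
  exists (1 + d)^-1; first by apply: inv1D_itv; case/andP: d4.
  move=> f sf; have [|x x1 sl] := @slice_of_lt_d0_star_at f t d t02 d4 sf.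
    by apply: lt_le_trans dd _; apply: ereal_inf_lbound; exists f.
  by exists x => //; apply: subset_trans sl _; exact: dball_subset.
Qed.

(** * Distances, diameters and the passage between balls and slices *)

Lemma cbc_bound C p : cbc C -> exists2 M : R, 0 < M & forall y, C y -> `|y - p| <= M.
Proof.
move=> [_ [_ [[M0 [_ bC]] _]]].
exists (`|M0| + 1 + `|p|); first by have := normr_ge0 M0; have := normr_ge0 p; lra.
move=> y Cy; apply: le_trans (ler_normB _ _) _; rewrite lerD2r.
by apply: bC => //; have := ler_norm M0; lra.
Qed.

Lemma dist_le p C y : C y -> dist p C <= `|p - y|.
Proof. by move=> Cy; apply: ge_inf; [exists 0 => _ [z _ <-]|exists y]. Qed.

Lemma le_dist p C (d : R) : C !=set0 -> (forall y, C y -> d <= `|p - y|) -> d <= dist p C.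
Proof.
move=> [c Cc] dC; apply: lb_le_inf; first by exists `|p - c|; exists c.
by move=> _ [y Cy <-]; exact: dC.
Qed.

Lemma le_diam C x y : cbc C -> C x -> C y -> `|x - y| <= diam C.
Proof.
move=> cC Cx Cy; apply: ub_le_sup; last by exists x => //; exists y.
have [M M0 CM] := cbc_bound 0 cC; exists (M + M) => _ [u Cu [v Cv <-]].
apply: le_trans (ler_normB _ _) _.
by have := CM u Cu; have := CM v Cv; rewrite !subr0; lra.
Qed.

Lemma closed_dist_gt0 C p : closed C -> ~ C p ->
  exists2 d : R, 0 < d & forall y, C y -> d <= `|y - p|.
Proof.
move=> cC Cp.
have /nbhs_normP[d /= d0 dC] : nbhs p (~` C) by apply: open_nbhs_nbhs; split=> //; exact: closed_openC.
exists d => // y Cy; rewrite leNgt; apply/negP => yd.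
by apply: (dC y) => //=; rewrite distrC.
Qed.

(* The radius l - d / 2 and the centre p + l x are those of [slice_ball] with
   e = d / (2 M), so that the ball misses p by d / 2. *)
Lemma cap_ball f x p C (alpha M d l : R) :
  0 < M -> 0 < d -> 0 <= l -> unit_sphere x -> is_dual f ->
  dslice x alpha `<=` dball f (d / (2 * M)) ->
  (forall y, C y -> d <= f y - f p) -> (forall y, C y -> `|y - p| <= M) ->
  M + d <= l * (1 - alpha) -> C `<=` cball (p + l *: x) (l - d / 2).
Proof.
move=> M0 d0 l0 x1 df sl dC CM hl y Cy.
have e0 : 0 <= d / (2 * M) by rewrite divr_ge0 ?mulr_ge0 ?ltW.
have := slice_ball e0 l0 x1 df sl (dC y Cy) (CM y Cy) hl.
have -> : d / (2 * M) * M = d / 2 by field; rewrite lt0r_neq0.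
by rewrite /cball /=; lra.
Qed.

Lemma MIP_of_semidenting :
  (forall f, dual_sphere f -> w_semidenting f) -> MIP X.
Proof.
move=> wf C cC; apply/seteqP; split=> [y Cy i /= Ci|p pC]; first exact: Ci.
apply: contrapT => Cp; have [C0 [clC [_ convC]]] := cC.
have [d d0 dC] := closed_dist_gt0 clC Cp.
have [M M0 CM] := cbc_bound p cC.
have [f sf fC] := separation_sphere d0 C0 convC dC.
have [|alpha [x [/andP[a0 a1] [x1 sl]]]] := wf f sf (d / (2 * M)).
  by rewrite divr_gt0 // mulr_gt0.
pose l := (M + d) / (1 - alpha).
have a1' : 0 < 1 - alpha by lra.
have l0 : 0 <= l by rewrite divr_ge0 // ltW //; lra.
have hl : M + d <= l * (1 - alpha) by rewrite /l divfK // lt0r_neq0.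
(* p would lie in this ball, but its distance l to the centre exceeds the radius l - d / 2. *)
have := pC (p + l *: x, l - d / 2) (cap_ball M0 d0 l0 x1 sf.1 sl fC CM hl).
rewrite /cball /= opprD addrA subrr sub0r normrN normrZ x1 mulr1 ger0_norm //.
lra.
Qed.

Lemma semidenting_of_MIP : MIP X ->
  forall f, dual_sphere f -> w_semidenting f.
Proof.
(* [slice_of_ball] yields the radius 4 d, hence e / 4; the bound 1 / 2 keeps d below 1. *)
move=> mip f sf e e0; pose d : R := Num.min (e / 4) 2^-1.
have d0 : 0 < d by rewrite lt_min divr_gt0 //= invr_gt0.
have d1 : d < 1 by apply: (@le_lt_trans _ _ 2^-1); [rewrite ge_min lexx orbT|lra].
have d01 : 0 < d < 1 by rewrite d0.
have cC := cbc_dual_cap sf d1.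
(* Since f 0 = 0 < d, the origin is outside the cap, and some ball containing the cap must miss
   it. *)
have [[z r] /= [capz zr]] : exists i : X * R,
    dual_cap f d `<=` cball i.1 i.2 /\ ~ cball i.1 i.2 0.
  apply: contrapT => nz.
  have : dual_cap f d 0.
    rewrite (mip _ cC) => i /= capi; apply: contrapT => i0.
    by apply: nz; exists i.
  by move=> [_]; rewrite (is_dual0 sf.1); lra.
have {zr}zr : r < `|z|.
  by rewrite ltNge; apply/negP => h; apply: zr; rewrite /cball /= sub0r normrN.
have [y0 Cy0 _] := dual_cap_approx sf d1.
have r0 : 0 <= r by apply: le_trans (capz _ Cy0).
have z0 : 0 < `|z| by exact: le_lt_trans zr.
pose alpha := Num.max (r / `|z|) (1 - d).
have a1 : alpha < 1 by rewrite gt_max ltr_pdivrMr // mul1r zr /=; lra.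
have a0 : 0 < alpha by rewrite lt_max; apply/orP; right; lra.
exists alpha, (`|z|^-1 *: z); split; first by rewrite a0.
split; first by rewrite /unit_sphere /= normrZ normfV normr_id mulVf // lt0r_neq0.
apply: subset_trans (slice_of_ball sf d01 capz zr _ _) _.
- by rewrite le_max lexx.
- by rewrite le_max lexx orbT.
- apply: dball_subset; suff : d <= e / 4 by lra.
  by rewrite ge_min lexx.
Qed.

(** Positivity puts p outside the ball; the point of the segment from z to p at distance r from z
    then realises the bound. *)
Lemma dist_cball_le p z (r : R) : 0 <= r -> 0 < dist p (cball z r) ->
  dist p (cball z r) <= `|p - z| - r.
Proof.
move=> r0 dp; have pr : r < `|p - z|.
  rewrite ltNge; apply/negP => pz.
  by have := @dist_le p (cball z r) p pz; rewrite subrr normr0; lra.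
have z0 : 0 < `|p - z| by exact: le_lt_trans pr.
pose c := r / `|p - z|.
have := @dist_le p (cball z r) (z + c *: (p - z)).
have -> : p - (z + c *: (p - z)) = (1 - c) *: (p - z).
  by rewrite opprD addrA scalerBl scale1r.
have c0 : 0 <= c by rewrite divr_ge0.
have c1 : c <= 1 by rewrite ler_pdivrMr // mul1r ltW.
rewrite /cball /= addrC addKr !normrZ !ger0_norm ?subr_ge0 //.
by rewrite mulrBl mul1r /c divfK ?lt0r_neq0 //; exact.
Qed.

Lemma UMIP_of_uniformly_semidenting : uniformly_w_semidenting -> UMIP X.
Proof.
move=> uw e e0.
(* Only the points within D of C matter: beyond that distance any ball of
   radius 1 / e centred in C does. *)
pose D := e^-1 + e; pose M := D + e^-1.
have i0 : 0 < e^-1 by rewrite invr_gt0.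
have M0 : 0 < M by rewrite /M /D; lra.
have [|alpha /andP[a0 a1] sl] := uw (e / (2 * M)).
  by rewrite divr_gt0 // mulr_gt0.
have a1' : 0 < 1 - alpha by lra.
pose l := (M + e) / (1 - alpha).
have l0 : 0 <= l by rewrite divr_ge0 // ltW //; lra.
have hl : M + e <= l * (1 - alpha) by rewrite /l divfK // lt0r_neq0.
(* This dominates both radii used below, 1 / e and l - e / 2, and depends on e alone because M,
   [alpha] and l do. *)
exists (e^-1 + l); split; first lra.
move=> C p cC diC dpC; have [[c Cc] [_ [_ convC]]] := cC.
have [far|[y0 Cy0 y0D]] : (forall y, C y -> D <= `|y - p|) \/ exists2 y, C y & `|y - p| < D.
  have [|nf] := pselect (exists2 y, C y & `|y - p| < D); [by right|left] => y Cy.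
  by rewrite leNgt; apply/negP => yD; apply: nf; exists y.
- exists c, e^-1; split.
    by move=> y Cy; apply: le_trans (le_diam cC Cy Cc) _; exact: ltW.
  split; last lra.
  apply: le_dist; first by exists c; rewrite /cball /= subrr normr0 ltW.
  move=> y; rewrite /cball /= => yc.
  (* The distance from y to p is at least D - 1 / e = e. *)
  have := far c Cc; rewrite distrC; have := ler_distD y p c; rewrite /D; lra.
- have CM y : C y -> `|y - p| <= M.
    move=> Cy; have := ler_distD y0 y p; have := le_diam cC Cy Cy0; rewrite /M; lra.
  have dC y : C y -> e <= `|y - p|.
    by move=> Cy; rewrite distrC; apply: le_trans dpC _; exact: dist_le.
  have [f sf fC] := @separation_sphere _ _ C p e e0 (ex_intro _ c Cc) convC dC.
  have [x x1 slx] := sl f sf.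
  have CB := cap_ball M0 e0 l0 x1 sf.1 slx fC CM hl.
  exists (p + l *: x), (l - e / 2); split=> //; split; last lra.
  apply: le_dist; first by exists c; exact: CB.
  move=> y; rewrite /cball /= => yB.
  have := ler_distD y p (p + l *: x).
  rewrite [`|p - (p + _)|]distrC [p + _ - p]addrC addKr normrZ x1 mulr1 ger0_norm //.
  lra.
Qed.

Lemma uniformly_semidenting_of_UMIP : UMIP X -> uniformly_w_semidenting.
Proof.
(* As before e / 4 matches the radius 4 d; the bound 1 / 4 makes the cap admissible, its diameter
   being at most 2 < 4 <= 1 / d. *)
move=> um e e0; pose d : R := Num.min (e / 4) 4^-1.
have d0 : 0 < d by rewrite lt_min divr_gt0 //= invr_gt0.
have d4 : d <= 4^-1 by rewrite ge_min lexx orbT.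
have d1 : d < 1 by lra.
have d01 : 0 < d < 1 by rewrite d0.
have [K [K0 HK]] := um d d0.
have Kd : 0 < K + d / 2 by lra.
(* From r <= K and ||z|| >= r + d / 2 follows r / ||z|| <= K / (K + d / 2), a bound free of f. *)
pose alpha := Num.max (K / (K + d / 2)) (1 - d).
have a1 : alpha < 1 by rewrite gt_max ltr_pdivrMr // mul1r; apply/andP; split; lra.
have a0 : 0 < alpha by rewrite lt_max; apply/orP; right; lra.
exists alpha; first by rewrite a0.
move=> f sf; have [df f1] := sf; have cC := cbc_dual_cap sf d1.
have [y0 Cy0 _] := dual_cap_approx sf d1.
have [||z [r [capz [dz rK]]]] := HK (dual_cap f d) 0 cC.
- apply: (@le_lt_trans _ _ 2).
    apply: ge_sup; first by exists `|y0 - y0|; exists y0 => //; exists y0.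
    move=> _ [u [u1 _] [v [v1 _] <-]]; apply: le_trans (ler_normB _ _) _; lra.
  apply: (@lt_le_trans _ _ 4); first lra.
  by rewrite -[4]invrK lef_pV2 ?posrE ?invr_gt0.
- apply: le_dist; first by exists y0.
  move=> y [_ dy]; rewrite sub0r normrN; apply: le_trans dy _.
  exact: dual_ball_le (dual_sphere_ball sf).
have r0 : 0 <= r by apply: le_trans (capz _ Cy0).
have := @dist_cball_le 0 z r r0; rewrite sub0r normrN => dzr.
have {dzr}rz : d / 2 <= `|z| - r by apply: le_trans dz (dzr (lt_le_trans _ dz)); rewrite divr_gt0.
have z0 : 0 < `|z| by lra.
have rz' : r < `|z| by lra.
exists (`|z|^-1 *: z).
  by rewrite /unit_sphere /= normrZ normfV normr_id mulVf // lt0r_neq0.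
apply: subset_trans (slice_of_ball sf d01 capz rz' _ _) _.
- rewrite le_max; apply/orP; left.
  rewrite ler_pdivrMr // mulrAC ler_pdivlMr //.
  have : r * (d / 2) <= K * (d / 2) by rewrite ler_wpM2r //; lra.
  have : K * (r + d / 2) <= K * `|z| by rewrite ler_wpM2l //; lra.
  lra.
- by rewrite le_max lexx orbT.
- apply: dball_subset; suff : d <= e / 4 by lra.
  by rewrite ge_min lexx.
Qed.

End Intersection.

Theorem mainTheorem7 (R : realType) (X : completeNormedModType R) :
  (forall f : X -> R, dual_sphere f ->
     (w_semidenting f <-> forall t : R, 0 < t < 2 -> (0 < d0_star_at f t)%E))
  /\ (MIP X <-> forall f : X -> R, dual_sphere f ->
                  forall t : R, 0 < t < 2 -> (0 < d0_star_at f t)%E)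
  /\ (UMIP X <-> forall t : R, 0 < t < 2 -> (0 < @d0_star R X t)%E).
Proof.
split; first by move=> f; exact: semidentingP.
split; split.
- by move=> /semidenting_of_MIP wf f sf; apply/(semidentingP sf); exact: wf.
- by move=> d0; apply: MIP_of_semidenting => f sf; apply/(semidentingP sf); exact: d0.
- by move=> /uniformly_semidenting_of_UMIP /uniformly_semidentingP.
- by move=> /uniformly_semidentingP /UMIP_of_uniformly_semidenting.
Qed.
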